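(* For $n\ge1$, $$T_4(\mathcal A_n)=\det(\mathbb I_n+M_n),$$ where $\mathbb I_n$ is the $n\times n$ identity matrix and $M_n$ is the $n\times n$ matrix with entries $(M_n)_{i,j}=\tilde S_{i,j+1}$ for $i,j=0,1,\dots,n-1$.
   Context: A Schröder path here is a lattice path in $\mathbb Z^2$ with steps $(-1,0)$ (left), $(0,1)$ (up) and $(-1,1)$ (diagonal). A restricted Schröder path is a Schröder path whose last step is not an up step. $\tilde S_{i,j}$ denotes the number of restricted Schröder paths from $(i,0)$ to $(0,j)$ (so $\tilde S_{0,j}=0$). A family of paths is non-intersecting if no two of its paths share a vertex. $T_4(\mathcal A_n)$ denotes the number of domino tilings of the $2n\times 2n$ Aztec-like quasi-square domain $\mathcal A_n$ with a central cross-shaped hole that are invariant under quarter-turn rotation about the center; via the standard domino-to-Schröder-path bijection on a fundamental domain, $T_4(\mathcal A_n)$ equals the number of pairs $(I,\mathcal P)$ where $I=\{i_1<\dots<i_\ell\}\subseteq\{0,1,\dots,n-1\}$ (possibly empty) and $\mathcal P$ is a non-intersecting family of restricted Schröder paths, the $k$-th going from $(i_k,0)$ to $(0,i_k+1)$. *)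

(* Defs.v *)
From mathcomp Require Import all_boot all_order all_algebra.

Set Implicit Arguments.
Unset Strict Implicit.
Unset Printing Implicit Defensive.

Import GRing.Theory Num.Theory.

Local Open Scope ring_scope.

(* ---- The holey quasi-square A_n and its domino tilings ---- *)

(* The unit cells are drawn as tilted squares (diamonds), so that the Aztec-like
   zig-zag boundary of A_n runs horizontally and vertically.  The cells are
   centred at the points (u, v) of Z^2 with u = v mod 2 (which of the two common
   parities is the chessboard colour), and two cells share an edge iff
   |u - u'| = |v - v'| = 1.  Only -2n <= u, v <= 2n is needed; the ordinals
   below are u + 2n and v + 2n, so that [rev_ord] is the negation of a
   coordinate. *)
Definition point (n : nat) : finType := ('I_(4 * n).+1 * 'I_(4 * n).+1)%type.

Definition ucoord (n : nat) (c : point n) : int := (c.1 : nat)%:Z - (2 * n)%:Z.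
Definition vcoord (n : nat) (c : point n) : int := (c.2 : nat)%:Z - (2 * n)%:Z.

Definition cell (n : nat) (c : point n) : bool := odd c.1 == odd c.2.

(* the quarter turn (u, v) |-> (- v, u) about the centre *)
Definition quarter_turn (n : nat) (c : point n) : point n := (rev_ord c.2, c.1).

Definition adjacent (n : nat) (c c' : point n) : bool :=
  (`|ucoord c - ucoord c'| == 1) && (`|vcoord c - vcoord c'| == 1).

(* the central cell (0, 0) and its four neighbours (+-1, +-1) *)
Definition cross_hole (n : nat) (c : point n) : bool :=
  (`|ucoord c| <= 1) && (`|vcoord c| <= 1).

(* The odd cells of the square |u|, |v| < 2n form a 2n x 2n array. *)
Definition square (n : nat) (c : point n) : bool :=
  (`|ucoord c| < (2 * n)%:Z) && (`|vcoord c| < (2 * n)%:Z).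

(* The n - 1 even cells attached to the top side of the square, to the right of
   the centre; their images under quarter_turn are attached to the other three sides. *)
Definition top_teeth (n : nat) (c : point n) : bool :=
  (vcoord c == (2 * n)%:Z) && (0 < ucoord c < (2 * n)%:Z).

(* A fundamental domain for the quarter turn consists of the even cells (2x, 2y)
   with 1 <= x <= n-1, 0 <= y <= n, and of the odd cells (2x+1, 2y+1) with
   0 <= x, y <= n-1, (x, y) <> (0, 0).  Encoding a tiling by the even cells whose
   partner is not the one at (+1, -1), with (2x, 2y) read as the vertex (x, y),
   gives Schroeder paths from the points (i, 0) to the points (0, i + 1). *)
Definition quasi_square (n : nat) : {set point n} :=
  [set c | [&& cell c, ~~ cross_hole c
             & square c || [exists k : 'I_4, top_teeth (iter k (@quarter_turn n) c)]]].

Definition domino (n : nat) (d : {set point n}) : bool :=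
  [exists c : point n, exists c' : point n, adjacent c c' && (d == [set c; c'])].

Definition domino_tiling (n : nat) (T : {set {set point n}}) : bool :=
  partition T (quasi_square n) && [forall d in T, domino d].

Definition quarter_turn_invariant (n : nat) (T : {set {set point n}}) : bool :=
  [set (@quarter_turn n) @: d | d : {set point n} in T] == T.

Definition T4 (n : nat) : nat :=
  #|[set T : {set {set point n}} | domino_tiling T && quarter_turn_invariant T]|.

(* ---- Restricted Schroeder paths ---- *)

Definition left_step : int * int := (-1, 0).
Definition up_step : int * int := (0, 1).
Definition diag_step : int * int := (-1, 1).

Definition step : finType := seq_sub [:: left_step; up_step; diag_step].

Definition step_vec (s : step) : int * int := ssval s.

Definition schroeder_path (a b : int * int) (w : seq step) : bool :=
  a + \sum_(s <- w) step_vec s == b.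

(* The default value up_step excludes the empty path, which has no last step;
   it could only occur from (0, 0) to itself. *)
Definition restricted (w : seq step) : bool :=
  last up_step [seq step_vec s | s <- w] != up_step.

(* A path from (i, 0) to (0, j) has at most i + j steps, since each step
   increases y - x by 1 or 2; hence the length bound excludes no path. *)
Definition restricted_schroeder_count (i j : nat) : nat :=
  #|[set w : {bseq (i + j) of step} |
      schroeder_path (i%:Z, 0) (0, j%:Z) w && restricted w]|.

Definition schroeder_mx (n : nat) : 'M[int]_n :=
  \matrix_(i < n, j < n) (restricted_schroeder_count i j.+1)%:Z.

(* Main.v *)
Require Import Defs.
From mathcomp Require Import all_boot all_order all_algebra.
From mathcomp Require Import all_fingroup zify.

(* A fundamental domain of the quarter turn has one even cell (2x, 2y) for each
   vertex (x, y) with 1 <= x < n, 0 <= y <= n.  Comparing an invariant tiling with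
   the one in which every such cell is paired with (2x+1, 2y-1) turns it into a
   permutation sigma of the grid 0 <= x < n, 0 <= y <= n that fixes a vertex, or
   moves it by a Schroeder step if x > 0, or wraps (0, i+1) to (i, 0).

   The number of disjoint paths separating a vertex from the origin is constant
   along the orbits of sigma (conservation of flow through the columns), and it
   distinguishes the end points of the wraps; since steps alone cannot close up,
   every nontrivial cycle of sigma wraps exactly once.  Hence the sign of sigma is
   (-1)^(number of steps), and the permutations are counted by the determinant of
   the matrix A = 1 - steps + wraps.

   Finally A = B + U P with B = 1 - steps unitriangular and U P the wraps, and
   B X = U is solved by the numbers X of paths that stop when they hit x = 0, so
   det A = det (1 + X P) = det (1 + P X) = det (1 + M). *)

Set Implicit Arguments.
Unset Strict Implicit.
Unset Printing Implicit Defensive.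

Import GRing.Theory Num.Theory.

Local Open Scope ring_scope.

(** * Counting restricted paths *)

(** An explicit enumeration, so that counts over [{bseq N of T}] obey a recursion on the first
    letter. *)
Fixpoint words (T : finType) (N : nat) : seq (seq T) :=
  if N is N'.+1 then [::] :: [seq s :: w | s <- enum T, w <- words T N']
  else [:: [::]].

Lemma mem_words (T : finType) N (w : seq T) : (w \in words T N) = (size w <= N)%N.
Proof.
elim: N w => [|N IH] [|s w] //=; rewrite inE /= ltnS -IH.
apply/allpairsP/idP => [[[s' w'] /= [_ w'N [_ ->]]] // | wN].
by exists (s, w); rewrite mem_enum.
Qed.

Lemma words_uniq (T : finType) N : uniq (words T N).
Proof.
elim: N => //= N IH; apply/andP; split.
  by apply/negP => /allpairsP[[s w] []].
by apply: allpairs_uniq (enum_uniq _) IH _ => -[s w] [s' w'] _ _ /= [-> ->].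
Qed.

Lemma card_bseq_pred (T : finType) N (P : pred (seq T)) :
  #|[set w : {bseq N of T} | P w]| = count P (words T N).
Proof.
rewrite cardE -(size_map val) -size_filter; apply: perm_size.
apply: uniq_perm; rewrite ?filter_uniq ?words_uniq ?(map_inj_uniq val_inj) ?enum_uniq //.
move=> w; rewrite mem_filter mem_words; apply/mapP/andP.
  by move=> [u]; rewrite mem_enum inE => Pu ->; rewrite size_bseq.
by move=> [Pw wN]; exists (Bseq wN); rewrite ?mem_enum ?inE.
Qed.

Lemma count_wordsS (T : finType) N (P : pred (seq T)) :
  count P (words T N.+1) = (P [::] + \sum_(s <- enum T) count (fun w => P (s :: w)) (words T N))%N.
Proof.
rewrite /=; congr addn; rewrite count_flatten sumnE !big_map.
by apply: eq_bigr => s _; rewrite count_map.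
Qed.

Lemma big_step (f : int * int -> nat) :
  (\sum_(s <- enum step) f (step_vec s) = f left_step + f up_step + f diag_step)%N.
Proof.
have pe : perm_eq [seq step_vec s | s <- enum step] [:: left_step; up_step; diag_step].
  apply: uniq_perm => //; first by rewrite (map_inj_uniq val_inj) enum_uniq.
  move=> p; apply/mapP/idP => [[s _ ->]|pin]; first exact: ssvalP.
  by exists (SeqSub pin); rewrite ?mem_enum.
by rewrite -(big_map step_vec xpredT f) (perm_big _ pe) /= !big_cons big_nil addn0 addnA.
Qed.

(** [d] stands for the step taken just before the word: as default value of [last], it carries the
    condition on the last step through a recursion on the first letter. *)
Definition path_count N (a b d : int * int) : nat :=
  count (fun w : seq step => (a + \sum_(s <- w) step_vec s == b)
           && (last d [seq step_vec s | s <- w] != up_step)) (words step N).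

Lemma path_countS N a b d :
  path_count N.+1 a b d =
  (((a == b) && (d != up_step)) + (path_count N (a + left_step)%R b left_step
   + path_count N (a + up_step)%R b up_step + path_count N (a + diag_step)%R b diag_step))%N.
Proof.
have := big_step (fun v => path_count N (a + v) b v); move=> /= <-.
rewrite {1}/path_count count_wordsS big_nil addr0; congr addn.
apply: eq_bigr => s _; apply: eq_count => w /=.
by rewrite big_cons addrA.
Qed.

Lemma path_count0 a b d : path_count 0 a b d = (a == b) && (d != up_step) :> nat.
Proof. by rewrite /path_count /= big_nil addr0 addn0. Qed.

Lemma pairE (p q : int * int) : (p == q) = (p.1 == q.1) && (p.2 == q.2).
Proof. by []. Qed.

(** No step increases x or decreases y. *)
Lemma path_count_out N (a b d : int * int) :
  (a.1 < b.1) || (b.2 < a.2) -> path_count N a b d = 0%N.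
Proof.
elim: N a d => [|N IH] a d ab; first by rewrite path_count0 pairE; case: eqP => //=; case: eqP => //=; lia.
rewrite path_countS !IH /=; try lia.
by rewrite pairE; case: eqP => //=; case: eqP => //=; lia.
Qed.

(* Lattice paths with steps left, up, diagonal from (i, 0) to (0, k) that stop
   as soon as they reach the line x = 0; so the empty path counts. *)
Fixpoint hit_count (i : nat) : nat -> nat :=
  if i is i'.+1 then
    fix hit_row k := if k is k'.+1 then hit_count i' k + hit_row k' + hit_count i' k'
                     else hit_count i' 0%N
  else fun k => (k == 0%N : nat).

Lemma hit_countSS i k :
  hit_count i.+1 k.+1 = (hit_count i k.+1 + hit_count i.+1 k + hit_count i k)%N.
Proof. by []. Qed.

(** On the line x = 0 only up steps can still lead to the end point, so a path that goes on after
    reaching this line ends with an up step: the restricted paths are those that stop there. In the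
    exceptional case the path is already on the line after an up step, which rules out even the
    empty continuation. *)
Lemma path_countE N (i k : nat) (y : int) d : (i + k <= N)%N ->
  path_count N (i%:Z, y) (0, y + k%:Z) d =
  if (i == 0%N) && (d == up_step) then 0%N else hit_count i k.
Proof.
elim: N i k y d => [|N IH] i k y d ikN.
  have [-> ->] : i = 0%N /\ k = 0%N by lia.
  by rewrite path_count0 pairE /= addr0 !eqxx /=; case: (_ == _).
rewrite path_countS pairE /=.
case: i ikN => [|i] ikN.
  rewrite !(path_count_out N (a := (_, _) + left_step)) ?(path_count_out N (a := (_, _) + diag_step)) //=.
  case: k ikN => [|k] ikN.
    by rewrite path_count_out /= ?addr0 ?eqxx /=; [case: (_ == _)|lia].
  have -> : (0%:Z, y) + up_step = (0%:Z, y + 1) by rewrite /up_step /GRing.add /= /add_pair /= addr0.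
  have -> : y + k.+1%:Z = (y + 1) + k%:Z by lia.
  rewrite IH; last lia.
  have -> : (y == y + 1 + k) = false by lia.
  by rewrite /= ; case: (_ == _).
have -> : (i.+1%:Z, y) + left_step = (i%:Z, y).
  by rewrite /left_step /GRing.add /= /add_pair /=; congr pair; lia.
have -> : (i.+1%:Z, y) + diag_step = (i%:Z, y + 1).
  by rewrite /left_step /GRing.add /= /add_pair /=; congr pair; lia.
have -> : (i.+1%:Z, y) + up_step = (i.+1%:Z, y + 1).
  by rewrite /left_step /GRing.add /= /add_pair /=; congr pair; lia.
rewrite IH; last lia.
rewrite andbF add0n.
case: k ikN => [|k] ikN.
  by rewrite !path_count_out /= ?andbF ?addn0 //; lia.
have -> : y + k.+1%:Z = (y + 1) + k%:Z by lia.
rewrite !IH; try lia.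
by rewrite /= andbF.
Qed.

Arguments hit_count : simpl never.

Lemma restricted_schroeder_countE i k :
  restricted_schroeder_count i k.+1 = hit_count i k.+1.
Proof.
rewrite /restricted_schroeder_count.
rewrite (card_bseq_pred _ (fun w => schroeder_path (i%:Z, 0) (0, k.+1%:Z) w && restricted w)).
have := @path_countE (i + k.+1) i k.+1 0 up_step (leqnn _).
rewrite add0r eqxx andbT /path_count /schroeder_path /restricted => ->.
by case: i.
Qed.

(** * The determinant of the quotient graph *)

(** The Weinstein-Aronszajn identity: multiplying [L] by the same unitriangular block matrix on the
    right or on the left makes it block triangular, so both sides equal the determinant of [L]. *)
Lemma det_1addmulC (R : comNzRingType) m n (X : 'M[R]_(m, n)) (Y : 'M[R]_(n, m)) :
  \det (1%:M + X *m Y) = \det (1%:M + Y *m X).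
Proof.
pose L := block_mx 1%:M (- X) Y 1%:M.
have e1 : L *m block_mx 1%:M X 0 1%:M = block_mx 1%:M 0 Y (1%:M + Y *m X).
  by rewrite mulmx_block !mul1mx !mulmx1 !mulmx0 !addr0 addrN [1%:M + _]addrC.
have e2 : block_mx 1%:M X 0 1%:M *m L = block_mx (1%:M + X *m Y) 0 Y 1%:M.
  by rewrite mulmx_block !mul1mx !mulmx1 !mul0mx !add0r addNr.
have := congr1 determinant e1; rewrite det_mulmx det_ublock !det1 !mulr1 det_lblock det1 mul1r => <-.
by have := congr1 determinant e2; rewrite det_mulmx det_ublock !det1 !mul1r det_lblock det1 mulr1.
Qed.

Definition step_rel (p q : nat * nat) : bool :=
  (0 < p.1)%N && [|| q == (p.1.-1, p.2), q == (p.1, p.2.+1) | q == (p.1.-1, p.2.+1)].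

(** A wrap leads from the end point of a path back to its starting point, so that families of
    disjoint paths become families of disjoint cycles. *)
Definition wrap_rel (p q : nat * nat) : bool :=
  [&& p.1 == 0%N, (0 < p.2)%N & q == (p.2.-1, 0%N)].

Lemma step_rel_irr p : step_rel p p = false.
Proof. by case: p => x y; rewrite /step_rel !xpair_eqE /=; lia. Qed.

Lemma wrap_rel_irr p : wrap_rel p p = false.
Proof. by case: p => x y; rewrite /wrap_rel !xpair_eqE /=; lia. Qed.

Lemma step_wrapF p q : step_rel p q -> wrap_rel p q = false.
Proof. by rewrite /step_rel /wrap_rel; case: p.1. Qed.

(* Columns are numbered from right to left, so that every Schroeder step
   increases the index. *)
Definition pos (n : nat) (v : 'I_(n * n.+1)) : nat * nat :=
  ((n.-1 - v %/ n.+1)%N, (v %% n.+1)%N).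

Arguments pos : simpl never.

Lemma pos_lt (n : nat) (v : 'I_(n * n.+1)) : ((pos v).1 < n)%N.
Proof. by rewrite /pos /=; case: n v => [|n] v; [case: v | rewrite ltnS leq_subr]. Qed.

Lemma pos_le (n : nat) (v : 'I_(n * n.+1)) : ((pos v).2 <= n)%N.
Proof. by rewrite -ltnS ltn_pmod. Qed.

Lemma val_pos (n : nat) (v : 'I_(n * n.+1)) :
  (v = (n.-1 - (pos v).1) * n.+1 + (pos v).2 :> nat)%N.
Proof.
rewrite /pos /= {1}(divn_eq v n.+1) subKn //.
have := ltn_divLR v n (ltn0Sn n); rewrite ltn_ord; lia.
Qed.

Lemma pos_inj (n : nat) : injective (@pos n).
Proof. by move=> v w vw; apply/ord_inj; rewrite (val_pos v) vw -val_pos. Qed.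

Lemma pos_onto (n x y : nat) : (x < n)%N -> (y <= n)%N ->
  {v : 'I_(n * n.+1) | pos v = (x, y)}.
Proof.
move=> xn yn.
have vP : ((n.-1 - x) * n.+1 + y < n * n.+1)%N.
  have : ((n.-1 - x) * n.+1 <= n.-1 * n.+1)%N by rewrite leq_mul2r leq_subr orbT.
  have : (n * n.+1 = n.-1 * n.+1 + n.+1)%N by case: n xn yn => // n _ _; rewrite /= mulSn addnC.
  lia.
exists (Ordinal vP); rewrite /pos /= divnMDl // modnMDl divn_small // modn_small // addn0.
by congr pair; lia.
Qed.

Lemma step_rel_ltn (n : nat) (v w : 'I_(n * n.+1)) :
  step_rel (pos v) (pos w) -> (v < w)%N.
Proof.
have := pos_lt v; have := pos_lt w; have := pos_le v; have := pos_le w.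
rewrite !val_pos; case: (pos v) (pos w) => [x y] [x' y'] /= yn yn' xn xn'.
rewrite /step_rel !xpair_eqE /= => /andP[x0 /or3P[]] /andP[/eqP-> /eqP->].
- have -> : (n.-1 - x.-1 = (n.-1 - x).+1)%N by lia.
  by rewrite mulSn; lia.
- by lia.
- have -> : (n.-1 - x.-1 = (n.-1 - x).+1)%N by lia.
  by rewrite mulSn; lia.
Qed.

(** The zero case takes care of steps from the row y = n that leave the grid. *)
Lemma sum_pos (n : nat) (F : nat * nat -> int) p :
  \sum_(w : 'I_(n * n.+1)) (pos w == p)%:R * F (pos w) =
  if (p.1 < n)%N && (p.2 <= n)%N then F p else 0.
Proof.
case: ifP => [/andP[p1 p2]|pF]; last first.
  apply: big1 => w _; case: eqP => [wp|_]; last by rewrite mul0r.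
  by move: pF; rewrite -wp pos_lt pos_le.
have [v vp] := pos_onto p1 p2; rewrite -surjective_pairing in vp.
rewrite (bigD1 v) //= vp eqxx mul1r big1 ?addr0 // => w wv.
by rewrite -vp (inj_eq (@pos_inj n)) (negPf wv) mul0r.
Qed.

(** This is the matrix X of the outline; [end_mx] is U, [start_mx] is P, [step_mx] is B and
    [quotient_mx] is A. The test guards the truncated subtraction: no path descends. *)
Definition hit_mx (n : nat) : 'M[int]_(n * n.+1, n) :=
  \matrix_(v, j) (if ((pos v).2 <= j.+1)%N then (hit_count (pos v).1 (j.+1 - (pos v).2))%:Z else 0).

Definition end_mx (n : nat) : 'M[int]_(n * n.+1, n) :=
  \matrix_(v, j) (pos v == (0, j.+1)%N)%:R.

Definition start_mx (n : nat) : 'M[int]_(n, n * n.+1) :=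
  \matrix_(i, v) (pos v == (nat_of_ord i, 0%N))%:R.

Definition step_mx (n : nat) : 'M[int]_(n * n.+1) :=
  \matrix_(v, w) ((v == w)%:R - (step_rel (pos v) (pos w))%:R).

Definition quotient_mx (n : nat) : 'M[int]_(n * n.+1) :=
  \matrix_(v, w) ((v == w)%:R - (step_rel (pos v) (pos w))%:R + (wrap_rel (pos v) (pos w))%:R).

Lemma det_step_mx n : \det (step_mx n) = 1.
Proof.
rewrite -det_tr det_trig; last first.
  apply/is_trig_mxP => i j ij; rewrite !mxE.
  case: (boolP (step_rel _ _)) => [/step_rel_ltn|_]; first by lia.
  by rewrite subr0; case: eqP => // ji; rewrite ji ltnn in ij.
by rewrite big1 // => i _; rewrite !mxE eqxx step_rel_irr subr0.
Qed.

Lemma quotient_mxE n : quotient_mx n = step_mx n + end_mx n *m start_mx n.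
Proof.
apply/matrixP => v w; rewrite !mxE; congr (_ + _).
under eq_bigr do rewrite !mxE.
have [vw|vw] := boolP (wrap_rel _ _).
  move: vw (pos_lt w); rewrite /wrap_rel => /and3P[/eqP v1 v2 /eqP wE]; rewrite wE /= => lt.
  (* The wrap from (0, i+1) to (i, 0) comes from the index i alone. *)
  rewrite (bigD1 (Ordinal lt)) //= big1 => [|j jv].
    rewrite prednK //; have -> : pos v == (0, v %% n.+1)%N by rewrite -v1.
    by rewrite eqxx mulr1 addr0.
  rewrite [in X in _ * X]xpair_eqE /= andbT.
  by move: jv; rewrite eq_sym -val_eqE /= => /negPf ->; rewrite mulr0.
rewrite big1 // => j _; apply/eqP; rewrite mulf_eq0 !pnatr_eq0 !eqb0 -negb_and.
apply: contra vw => /andP[/eqP-> /eqP->]; by rewrite /wrap_rel /=.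
Qed.

(** Paths are split by their first step. On x = 0 no step starts, and only the empty path remains,
    which gives the right-hand side. *)
Lemma step_mx_hit n : step_mx n *m hit_mx n = end_mx n.
Proof.
apply/matrixP => v j; rewrite !mxE.
pose F (p : nat * nat) : int :=
  if (p.2 <= j.+1)%N then (hit_count p.1 (j.+1 - p.2))%:Z else 0.
have XE w : hit_mx n w j = F (pos w) by rewrite mxE.
under eq_bigr do rewrite XE mxE mulrBl.
rewrite sumrB (bigD1 v) //= eqxx mul1r big1 ?addr0; last first.
  by move=> w wv; rewrite eq_sym (negPf wv) mul0r.
have := pos_lt v; have := pos_le v; case vE: (pos v) => [x y] /= yn xn.
case: x xn vE => [|x] xn vE.
  rewrite big1 ?subr0 => [|w _]; last by rewrite /step_rel mul0r.
  rewrite /F xpair_eqE /hit_count /=; case: leqP => yj; last by case: eqP => //; lia.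
  have -> : (j.+1 - y == 0)%N = (y == j.+1) by lia.
  by case: (_ == _).
have stepE w : (step_rel (x.+1, y) (pos w))%:R * F (pos w) =
    (pos w == (x, y))%:R * F (pos w) + (pos w == (x.+1, y.+1))%:R * F (pos w)
    + (pos w == (x, y.+1))%:R * F (pos w).
  rewrite /step_rel /= -!mulrDl; congr (_ * _); case: (pos w) => a b.
  by rewrite !xpair_eqE; do 4!case: eqP => //; try lia.
under eq_bigr do rewrite stepE.
rewrite !big_split /= !sum_pos /= (ltnW xn) xn yn /=.
rewrite /F /=; have jn := ltn_ord j.
(* Below the target height both upper neighbours lie in the grid, because j < n; at the target
   height only left steps contribute. *)
have [yj|yj|->] := ltngtP y j.+1.
- have -> : (y < n)%N by lia.
  have -> : (j.+1 - y = (j.+1 - y.+1).+1)%N by lia.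
  by rewrite hit_countSS; lia.
- rewrite !if_same; lia.
- by rewrite subnn !if_same !addr0 subrr.
Qed.

Lemma start_mx_hit n : start_mx n *m hit_mx n = schroeder_mx n.
Proof.
apply/matrixP => i j; rewrite !mxE.
pose F (p : nat * nat) : int :=
  if (p.2 <= j.+1)%N then (hit_count p.1 (j.+1 - p.2))%:Z else 0.
under eq_bigr do rewrite !mxE -/(F (pos _)).
by rewrite sum_pos /= ltn_ord /F /= restricted_schroeder_countE.
Qed.

Lemma det_quotient_mx n : \det (quotient_mx n) = \det (1%:M + schroeder_mx n).
Proof.
rewrite quotient_mxE -step_mx_hit -mulmxA -[X in X + _]mulmx1 -mulmxDr det_mulmx.
by rewrite det_step_mx mul1r det_1addmulC start_mx_hit.
Qed.

(** * Signs of the admissible permutations *)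

Definition allowed_rel (p q : nat * nat) : bool :=
  [|| q == p, step_rel p q | wrap_rel p q].

(** Among the moves only the up steps are not exits. The wrap from (0, 1) counts as one although (0,
    0) lies in the same column. *)
Definition side_exit (s : nat * nat -> nat * nat) (p : nat * nat) : bool :=
  wrap_rel p (s p) || step_rel p (s p) && ((s p).1 < p.1)%N.

Definition wraps_to (s : nat * nat -> nat * nat) (i : nat) : bool :=
  s (0, i.+1)%N == (i, 0)%N.

(* The number of paths separating p from the origin. *)
Definition path_rank (s : nat * nat -> nat * nat) (p : nat * nat) : nat :=
  (\sum_(k < p.2) side_exit s (p.1, k : nat) + \sum_(i < p.1) wraps_to s i)%N.

(* Both sides say whether s moves (x, y): the left-hand side by the way the orbit
   leaves it, the right-hand side by the way the orbit enters it. *)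
Lemma in_out_balance (s s' : nat * nat -> nat * nat) (x y : nat) :
  cancel s s' -> cancel s' s -> (forall p, allowed_rel p (s p)) ->
  (side_exit s (x, y) + ((0 < x) && (s (x, y) == (x, y.+1))) =
   (if y is y'.+1 then ((0 < x) && (s (x, y') == (x, y))) + (s (x.+1, y') == (x, y))
    else wraps_to s x)
   + (s (x.+1, y) == (x, y)))%N.
Proof.
move=> sK s'K al.
have eqs p q : (s p == q) = (s' q == p) by rewrite (can2_eq sK s'K) eq_sym.
have out : (side_exit s (x, y) + ((0 < x) && (s (x, y) == (x, y.+1))) = (s (x, y) != (x, y)))%N.
  case/or3P: (al (x, y)) => [/eqP e|st|wr].
  - by rewrite /side_exit e wrap_rel_irr step_rel_irr eqxx xpair_eqE (ltn_eqF (ltnSn y)) !andbF.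
  - rewrite /side_exit (step_wrapF st) st.
    case/andP: st => /= x0 /or3P[] /eqP -> /=; rewrite x0 !xpair_eqE; lia.
  - rewrite /side_exit wr; case/and3P: wr => /= /eqP -> y0 /eqP ->.
    by rewrite !xpair_eqE; lia.
(* The move that enters (x, y) is read off from its preimage: a wrap enters only at y = 0, an up or
   diagonal step only at y > 0. *)
rewrite out /wraps_to; have := al (s' (x, y)); rewrite s'K.
case: y out => [|y] _; rewrite !eqs /allowed_rel /step_rel /wrap_rel;
  case: (s' _) => a b; rewrite !xpair_eqE /=; lia.
Qed.

(** The balance summed over the segment (x, 0), ..., (x, y). Inflow comes from column x+1 and from
    the wrap to (x, 0); the diagonal step from (x+1, y) lands just above the segment, hence its
    correction term on the left. *)
Lemma side_exit_sum (s s' : nat * nat -> nat * nat) (x y : nat) :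
  cancel s s' -> cancel s' s -> (forall p, allowed_rel p (s p)) ->
  (\sum_(k < y.+1) side_exit s (x, k : nat) + ((0 < x) && (s (x, y) == (x, y.+1)))
     + (s (x.+1, y) == (x, y.+1))
   = \sum_(k < y.+1) side_exit s (x.+1, k : nat) + wraps_to s x)%N.
Proof.
move=> sK s'K al.
have sideS k : (side_exit s (x.+1, k) = (s (x.+1, k) == (x, k)) + (s (x.+1, k) == (x, k.+1)) :> nat)%N.
  move: (al (x.+1, k)); rewrite /allowed_rel /side_exit /step_rel /wrap_rel.
  by case: (s _) => a b; rewrite !xpair_eqE /=; lia.
elim: y => [|y IH].
  have := in_out_balance x 0 sK s'K al; rewrite !big_ord1 /= sideS; lia.
have := in_out_balance x y.+1 sK s'K al.
by move: IH; rewrite !big_ord_recr /= !sideS; lia.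
Qed.

(** For left and diagonal steps this is conservation of flow between columns x+1 and x, where
    injectivity of [s] removes the other moves into [s p]. An up step adds only the term of [p],
    which is no side exit. For a wrap see the last case. *)
Lemma path_rank_step (s s' : nat * nat -> nat * nat) p :
  cancel s s' -> cancel s' s -> (forall p, allowed_rel p (s p)) ->
  path_rank s (s p) = path_rank s p.
Proof.
move=> sK s'K al; have sI := can_inj sK.
have neq q q' : q != q' -> s q = s p -> (s q' == s p) = false.
  by move=> qq' <-; rewrite (inj_eq sI) eq_sym (negPf qq').
have /or3P[/eqP-> // | st | wr] := al p.
- case: p neq st => x y neq; rewrite /step_rel /= => /andP[].
  case: x neq => // x neq _ /or3P[] /eqP sE.
  + rewrite /path_rank sE /=; rewrite big_ord_recr /=.
    case: y neq sE => [|y] neq sE.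
      rewrite !big_ord0 /wraps_to.
      by rewrite -sE (neq (x.+1, 0)%N) ?addn0.
    have := side_exit_sum x y sK s'K al.
    rewrite -sE !(neq (x.+1, y.+1)) ?xpair_eqE ?andbF //=; lia.
  + rewrite /path_rank sE /= big_ord_recr /= {2}/side_exit sE /step_rel /wrap_rel /=.
    by rewrite ltnn andbF addn0.
  + rewrite /path_rank sE /= [in RHS]big_ord_recr /=.
    have := side_exit_sum x y sK s'K al.
    rewrite sE eqxx -{1}sE (neq (x.+1, y)) ?xpair_eqE ?andbF //=; try lia.
    rewrite [in X in _ = X -> _]big_ord_recr /= {3}/side_exit sE /step_rel /wrap_rel /=.
    by rewrite !xpair_eqE eqxx ltnSn /=; lia.
- case: p neq wr => x y neq; rewrite /wrap_rel /= => /and3P[/eqP-> y0 /eqP->].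
  case: y neq y0 => // y neq _ /=.
  (* On x = 0 the side exits are exactly the wraps, and there is none at the origin; after an index
     shift both ranks count the same wraps. *)
  rewrite /path_rank /= !big_ord0 addn0 add0n big_ord_recl /=.
  rewrite {1}/side_exit /wrap_rel /step_rel /= add0n.
  by apply: eq_bigr => k _; rewrite /side_exit /wrap_rel /step_rel /= orbF.
Qed.

(* The wrap at the smaller index is counted only by the rank of the larger one. *)
Lemma path_rank_inj (s : nat * nat -> nat * nat) i j :
  wraps_to s i -> wraps_to s j ->
  path_rank s (i, 0)%N = path_rank s (j, 0)%N -> i = j.
Proof.
rewrite /path_rank /= !big_ord0 !add0n.
wlog ij : i j / (i < j)%N => [hw wi wj|].
  by case: (ltngtP i j) => // ij e; [apply: hw | apply/esym/hw].
move=> wi _; rewrite -(big_mkord xpredT (fun k => wraps_to s k : nat)).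
rewrite -(big_mkord xpredT (fun k => wraps_to s k : nat)).
rewrite (big_cat_nat _ (n := i) (p := j)) //=; last exact: ltnW.
by rewrite (big_ltn ij) wi; lia.
Qed.

(** Extension by the identity outside the grid, which lets the flow argument run without boundary
    cases. *)
Definition plane_ext (n : nat) (sigma : 'S_(n * n.+1)) (p : nat * nat) : nat * nat :=
  if [pick v | pos v == p] is Some v then pos (sigma v) else p.

Lemma plane_ext_pos n (sigma : 'S_(n * n.+1)) v : plane_ext sigma (pos v) = pos (sigma v).
Proof.
rewrite /plane_ext; case: pickP => [w /eqP/pos_inj -> // | /(_ v)]; by rewrite eqxx.
Qed.

Lemma plane_extK n (sigma : 'S_(n * n.+1)) : cancel (plane_ext sigma) (plane_ext sigma^-1).
Proof.
move=> p; rewrite {2}/plane_ext; case: pickP => [v /eqP <-|none].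
  by rewrite plane_ext_pos permK.
by rewrite /plane_ext; case: pickP => // v; rewrite none.
Qed.

Definition allowed (n : nat) (sigma : 'S_(n * n.+1)) : bool :=
  [forall v, allowed_rel (pos v) (pos (sigma v))].

(* Every nontrivial cycle contains exactly one wrap: at least one since steps
   increase the index, at most one since the rank is constant on the cycle. *)
Lemma card_porbits_allowed n (sigma : 'S_(n * n.+1)) : allowed sigma ->
  #|porbits sigma| = #|[set v | ~~ step_rel (pos v) (pos (sigma v))]|.
Proof.
move=> /forallP al.
have alZ v : ~~ step_rel (pos v) (pos (sigma v)) ->
    sigma v = v \/ exists2 i, pos v = (0, i.+1)%N & pos (sigma v) = (i, 0)%N.
  move=> nst; have := al v; rewrite /allowed_rel (negPf nst) /=.
  case/orP => [/eqP/pos_inj|/and3P[/eqP v1 v2 /eqP vE]]; first by left.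
  by right; exists (pos v).2.-1; rewrite ?prednK // -v1 -surjective_pairing.
have alE p : allowed_rel p (plane_ext sigma p).
  rewrite /plane_ext; case: pickP => [v /eqP <- // |_].
  by rewrite /allowed_rel eqxx.
have s'K : cancel (plane_ext sigma^-1) (plane_ext sigma).
  by move=> p; rewrite -{1}(invgK sigma) plane_extK.
have rankE v w : w \in porbit sigma v ->
    path_rank (plane_ext sigma) (pos w) = path_rank (plane_ext sigma) (pos v).
  case/porbitP => k ->; elim: k => [|k IH]; first by rewrite perm1.
  by rewrite expgSr permM -IH -plane_ext_pos (path_rank_step _ (plane_extK sigma) s'K).
have fixE v w : sigma v = v -> w \in porbit sigma v -> w = v.
  move=> vE /porbitP[k ->]; elim: k => [|k IH]; first by rewrite perm1.
  by rewrite expgSr permM IH.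
have -> : porbits sigma = porbit sigma @: [set v | ~~ step_rel (pos v) (pos (sigma v))].
  apply/setP => O; apply/imsetP/imsetP => [[v _ ->]|[v _ ->]]; last by exists v.
  have vv : v \in porbit sigma v := porbit_id _ _.
  (* The vertex of largest index on a cycle cannot be left by a step. *)
  case: (arg_maxnP (fun w : 'I_(n * n.+1) => w : nat) vv) => w wv wmax.
  have {}wv : w \in porbit sigma v := wv.
  exists w; last by apply/eqP; rewrite eq_porbit_mem porbit_sym.
  rewrite inE; apply/negP => /step_rel_ltn; rewrite ltnNge => /negP; apply.
  apply: wmax; change (sigma w \in porbit sigma v).
  have /eqP <- : porbit sigma w == porbit sigma v by rewrite eq_porbit_mem.
  by have := mem_porbit sigma 1 w; rewrite expg1.
apply: card_in_imset => v w; rewrite !inE => /alZ vZ /alZ wZ vw.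
have wv : w \in porbit sigma v by rewrite vw porbit_id.
case: vZ => [vE|[i vi si]]; first by rewrite (fixE v w).
case: wZ => [wE|[j wj sj]]; first by rewrite (fixE w v) // -vw porbit_id.
(* Two wraps on one cycle have targets (i, 0) and (j, 0) of equal rank, so i = j. *)
have := rankE _ _ wv; rewrite -(path_rank_step (pos v) (plane_extK sigma) s'K alE).
rewrite -(path_rank_step (pos w) (plane_extK sigma) s'K alE) !plane_ext_pos si sj.
move/path_rank_inj => ji; apply: (@perm_inj _ sigma); apply: pos_inj; rewrite si sj.
by rewrite ji // /wraps_to -?vi -?wj plane_ext_pos ?si ?sj.
Qed.

(** The sign is given by the parity of the number of vertices plus the number of cycles. There are
    as many cycles as vertices that do not step, so modulo 2 only the stepping vertices remain. *)
Lemma sign_allowed n (sigma : 'S_(n * n.+1)) : allowed sigma ->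
  (-1) ^+ sigma = \prod_v (-1) ^+ step_rel (pos v) (pos (sigma v)) :> int.
Proof.
move=> al; rewrite prodrXr /odd_perm card_porbits_allowed // -oddD signr_odd.
rewrite -(cardsC [set v | ~~ step_rel (pos v) (pos (sigma v))]) addnAC addnn.
rewrite exprD -signr_odd odd_double mul1r; congr (_ ^+ _).
by rewrite -sum1_card big_mkcond; apply: eq_bigr => v _; rewrite !inE negbK; case: ifP.
Qed.

(** In the Leibniz expansion a permutation that is not allowed meets a zero entry. For an allowed
    one the entries -1 sit at its steps, and their product cancels the sign. *)
Lemma det_quotient_mx_allowed n :
  \det (quotient_mx n) = #|[set sigma : 'S_(n * n.+1) | allowed sigma]|%:Z.
Proof.
rewrite /determinant (bigID (@allowed n)) /= [X in _ + X]big1 ?addr0; last first.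
  move=> sigma /forallPn[v nal]; rewrite (bigD1 v) //= mxE.
  move: nal; rewrite /allowed_rel !negb_or (inj_eq (@pos_inj n)) eq_sym => /and3P[].
  by move=> /negPf-> /negPf-> /negPf->; rewrite subr0 addr0 mul0r mulr0.
rewrite -sum1dep_card -natz natr_sum; apply: eq_bigr => sigma al.
rewrite sign_allowed // -big_split /= big1 // => v _; rewrite mxE.
have /orP[/eqP/pos_inj vE|] := forallP al v; first by rewrite vE eqxx step_rel_irr wrap_rel_irr.
case: eqP => [<-|_] /orP[]; rewrite ?step_rel_irr ?wrap_rel_irr // => rel.
  by rewrite rel step_wrapF.
by rewrite rel; case: (boolP (step_rel _ _)) => [/step_wrapF|_] //; rewrite rel.
Qed.

(** * Cells of the quasi-square modulo the quarter turn *)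

Definition coords (n : nat) (c : point n) : nat * nat := (c.1 : nat, c.2 : nat).

Lemma coords_inj n : injective (@coords n).
Proof. by move=> [a b] [a' b'] [/val_inj -> /val_inj ->]. Qed.

Definition turn_coords (n : nat) (p : nat * nat) : nat * nat := ((4 * n - p.2)%N, p.1).

Lemma coords_iter_turn n k (c : point n) :
  coords (iter k (@quarter_turn n) c) = iter k (turn_coords n) (coords c).
Proof. by elim: k => //= k <-; rewrite /turn_coords /= -subSS. Qed.

Lemma coords_le n (c : point n) : ((coords c).1 <= 4 * n)%N && ((coords c).2 <= 4 * n)%N.
Proof. by case: c => a b; apply/andP; split; rewrite -ltnS ltn_ord. Qed.

Lemma iter_turn4 n (c : point n) : iter 4 (@quarter_turn n) c = c.
Proof.
apply: coords_inj; rewrite coords_iter_turn; have := coords_le c.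
by case: (coords c) => a b; rewrite /turn_coords /=; move=> /andP[? ?]; congr pair; lia.
Qed.

Lemma iter_turn_mod n k (c : point n) :
  iter k (@quarter_turn n) c = iter (k %% 4)%N (@quarter_turn n) c.
Proof.
rewrite {1}(divn_eq k 4) addnC iterD; congr iter.
by elim: (k %/ 4)%N => // m IH; rewrite mulSn iterD IH iter_turn4.
Qed.

(** [quasi_square] in natural coordinates centred at (2n, 2n): the hole is removed, then come the
    square and the teeth on the top, right, bottom and left sides. *)
Definition region (n : nat) (p : nat * nat) : bool :=
  [&& odd p.1 == odd p.2,
      ~~ ((2 * n <= p.1.+1) && (p.1 <= (2 * n).+1) && (2 * n <= p.2.+1) && (p.2 <= (2 * n).+1))%N
    & [|| [&& 0 < p.1, p.1 < 4 * n, 0 < p.2 & p.2 < 4 * n],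
          [&& p.2 == 4 * n, 2 * n < p.1 & p.1 < 4 * n],
          [&& p.1 == 4 * n, 0 < p.2 & p.2 < 2 * n],
          [&& p.2 == 0, 0 < p.1 & p.1 < 2 * n]
        | [&& p.1 == 0, 2 * n < p.2 & p.2 < 4 * n]]]%N.

Lemma mem_quasi_square n (c : point n) : (c \in quasi_square n) = region n (coords c).
Proof.
have teethE (c' : point n) : top_teeth c' =
    [&& (coords c').2 == 4 * n, 2 * n < (coords c').1 & (coords c').1 < 4 * n]%N.
  by rewrite /top_teeth /ucoord /vcoord /coords /=; lia.
have -> : (c \in quasi_square n) = [&& cell c, ~~ cross_hole c
   & square c || [|| top_teeth c, top_teeth (iter 1 (@quarter_turn n) c),
       top_teeth (iter 2 (@quarter_turn n) c) | top_teeth (iter 3 (@quarter_turn n) c)]].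
  rewrite inE; congr [&& _, _ & _ || _]; apply/existsP/or4P.
    by case=> -[[|[|[|[|k]]]] lt] // t; [constructor 1|constructor 2|constructor 3|constructor 4].
  by case=> t; [exists (@Ordinal 4 0 isT)|exists (@Ordinal 4 1 isT)
               |exists (@Ordinal 4 2 isT)|exists (@Ordinal 4 3 isT)].
have holeE : cross_hole c = ((2 * n <= (coords c).1.+1) && ((coords c).1 <= (2 * n).+1)
    && (2 * n <= (coords c).2.+1) && ((coords c).2 <= (2 * n).+1))%N.
  by rewrite /cross_hole /ucoord /vcoord /coords /=; lia.
have squareE : square c = [&& 0 < (coords c).1, (coords c).1 < 4 * n,
    0 < (coords c).2 & (coords c).2 < 4 * n]%N.
  by rewrite /square /ucoord /vcoord /coords /=; lia.
rewrite holeE squareE !teethE !coords_iter_turn /cell.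
have := coords_le c; rewrite -[c.1 : nat]/(coords c).1 -[c.2 : nat]/(coords c).2.
case: (coords c) => a b; rewrite /region /turn_coords /= => /andP[a4 b4].
by congr [&& _, ~~ _ & [|| _, _, _, _ | _]]; lia.
Qed.

Lemma adjacentE n (c c' : point n) :
  adjacent c c' =
  [&& ((coords c).1 == (coords c').1.+1) || ((coords c').1 == (coords c).1.+1)
    & ((coords c).2 == (coords c').2.+1) || ((coords c').2 == (coords c).2.+1)].
Proof. by rewrite /adjacent /ucoord /vcoord /coords /=; lia. Qed.

Lemma adjacent_turn n (c c' : point n) :
  adjacent (quarter_turn c) (quarter_turn c') = adjacent c c'.
Proof.
have := coords_le c; have := coords_le c'.
rewrite !adjacentE !(coords_iter_turn 1 _) /turn_coords /=; lia.
Qed.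

Lemma quasi_square_turn n (c : point n) :
  (quarter_turn c \in quasi_square n) = (c \in quasi_square n).
Proof.
rewrite !mem_quasi_square (coords_iter_turn 1) /turn_coords.
have := coords_le c; case: (coords c) => a b; rewrite /region /= => ab.
congr [&& _, ~~ _ & _]; lia.
Qed.

(** A vertex (x, y) stands both for the even cell (2x, 2y) and for its reference partner (2x+1,
    2y-1), the [odd_cell]. *)
Definition even_cell (n : nat) (p : nat * nat) : point n :=
  (inord (2 * n + 2 * p.1), inord (2 * n + 2 * p.2)).

(* The predecessor is harmless: 2n + 2y is positive for the vertices of the grid. *)
Definition odd_cell (n : nat) (p : nat * nat) : point n :=
  (inord (2 * n + 2 * p.1).+1, inord (2 * n + 2 * p.2).-1).

Lemma coords_even_cell n p : (p.1 < n)%N -> (p.2 <= n)%N ->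
  coords (even_cell n p) = (2 * n + 2 * p.1, 2 * n + 2 * p.2)%N.
Proof. by move=> p1 p2; rewrite /coords /= !inordK //; lia. Qed.

Lemma coords_odd_cell n p : (p.1 < n)%N -> (p.2 <= n)%N ->
  coords (odd_cell n p) = ((2 * n + 2 * p.1).+1, (2 * n + 2 * p.2).-1)%N.
Proof. by move=> p1 p2; rewrite /coords /= !inordK //; lia. Qed.

Lemma parity_turn n k (c : point n) : cell c ->
  odd (coords (iter k (@quarter_turn n) c)).1 = odd (coords c).1.
Proof.
move=> cc; rewrite coords_iter_turn.
(* The bounds belong to the induction because the turn uses truncated subtraction. *)
suff : odd (iter k (turn_coords n) (coords c)).1 = odd (coords c).1 /\
       odd (iter k (turn_coords n) (coords c)).2 = odd (coords c).1 /\
       ((iter k (turn_coords n) (coords c)).1 <= 4 * n)%N /\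
       ((iter k (turn_coords n) (coords c)).2 <= 4 * n)%N by case.
have := coords_le c; move: cc; rewrite /cell -[c.1 : nat]/(coords c).1 -[c.2 : nat]/(coords c).2.
move=> /eqP cc /andP[c1 c2].
elim: k => [|k /=]; first by rewrite -cc.
case: (iter _ _ _) => a b /= [ea [eb [a4 b4]]].
by rewrite oddB // oddM eb leq_subr.
Qed.

Section Vertices.
Variable n : nat.
Implicit Types v w : 'I_(n * n.+1).

Lemma even_cell_region v : (0 < (pos v).1)%N -> even_cell n (pos v) \in quasi_square n.
Proof.
have := pos_lt v; have := pos_le v; move=> v2 v1.
rewrite mem_quasi_square coords_even_cell //; move: v1 v2.
by case: (pos v) => x y; rewrite /region /=; lia.
Qed.

(** The exceptions (0, 0) and (0, 1) give the hole cells (1, -1) and (1, 1). *)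
Lemma odd_cell_region v :
  (odd_cell n (pos v) \in quasi_square n) = ~~ (((pos v).1 == 0%N) && ((pos v).2 <= 1)%N).
Proof.
have := pos_lt v; have := pos_le v; move=> v2 v1.
rewrite mem_quasi_square coords_odd_cell //; move: v1 v2.
by case: (pos v) => x y; rewrite /region /=; lia.
Qed.

Lemma even_cell_rep (c : point n) : c \in quasi_square n -> ~~ odd (coords c).1 ->
  exists k v, (0 < (pos v).1)%N /\ c = iter k (@quarter_turn n) (even_cell n (pos v)).
Proof.
rewrite mem_quasi_square; have := coords_le c; case E: (coords c) => [a b] /= ab reg oa.
have rep k x y : (0 < x)%N -> (x < n)%N -> (y <= n)%N ->
    coords c = iter k (turn_coords n) (2 * n + 2 * x, 2 * n + 2 * y)%N ->
    exists k v, (0 < (pos v).1)%N /\ c = iter k (@quarter_turn n) (even_cell n (pos v)).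
  move=> x0 xn yn cE; have [v vE] := pos_onto xn yn; exists k, v; rewrite vE; split=> //.
  by apply: coords_inj; rewrite coords_iter_turn cE coords_even_cell.
move: reg; rewrite /region /= => reg.
(* Four half-open quadrants, permuted by the turn, cover everything but the centre. *)
case: (boolP ((2 * n < a) && (2 * n <= b)))%N => [q0|q0].
  by apply: (rep 0%N (a./2 - n) (b./2 - n))%N; rewrite ?E /turn_coords /=; try congr pair; lia.
case: (boolP ((a <= 2 * n) && (2 * n < b)))%N => [q1|q1].
  by apply: (rep 1%N (b./2 - n) (n - a./2))%N; rewrite ?E /turn_coords /=; try congr pair; lia.
case: (boolP ((a < 2 * n) && (b <= 2 * n)))%N => [q2|q2].
  by apply: (rep 2 (n - a./2) (n - b./2))%N; rewrite ?E /turn_coords /=; try congr pair; lia.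
by apply: (rep 3 (n - b./2) (a./2 - n))%N; rewrite ?E /turn_coords /=; try congr pair; lia.
Qed.

Lemma odd_cell_rep (c : point n) : c \in quasi_square n -> odd (coords c).1 ->
  exists k v, c = iter k (@quarter_turn n) (odd_cell n (pos v)).
Proof.
rewrite mem_quasi_square; have := coords_le c; case E: (coords c) => [a b] /= ab reg oa.
have rep k x y : (x < n)%N -> (y <= n)%N ->
    coords c = iter k (turn_coords n) ((2 * n + 2 * x).+1, (2 * n + 2 * y).-1)%N ->
    exists k v, c = iter k (@quarter_turn n) (odd_cell n (pos v)).
  move=> xn yn cE; have [v vE] := pos_onto xn yn; exists k, v; rewrite vE.
  by apply: coords_inj; rewrite coords_iter_turn cE coords_odd_cell.
move: reg; rewrite /region /= => reg.
case: (boolP ((2 * n < a) && (2 * n <= b)))%N => [q0|q0].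
  by apply: (rep 0%N (a./2 - n) (b.+1./2 - n))%N; rewrite ?E /turn_coords /=; try congr pair; lia.
case: (boolP ((a <= 2 * n) && (2 * n < b)))%N => [q1|q1].
  by apply: (rep 1%N (b./2 - n) (n - a./2))%N; rewrite ?E /turn_coords /=; try congr pair; lia.
case: (boolP ((a < 2 * n) && (b <= 2 * n)))%N => [q2|q2].
  by apply: (rep 2 (n - a.+1./2) (n - b./2))%N; rewrite ?E /turn_coords /=; try congr pair; lia.
by apply: (rep 3 (n - b.+1./2) (a.+1./2 - n))%N; rewrite ?E /turn_coords /=; try congr pair; lia.
Qed.

Lemma even_cell_turn_inj k v w : (k < 4)%N -> (0 < (pos v).1)%N -> (0 < (pos w).1)%N ->
  iter k (@quarter_turn n) (even_cell n (pos v)) = even_cell n (pos w) -> k = 0%N /\ v = w.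
Proof.
move=> k4 v0 w0 /(congr1 (@coords n)).
rewrite coords_iter_turn !coords_even_cell ?pos_lt ?pos_le //.
suff H : iter k (turn_coords n) (2 * n + 2 * (pos v).1, 2 * n + 2 * (pos v).2)%N =
    (2 * n + 2 * (pos w).1, 2 * n + 2 * (pos w).2)%N -> k = 0%N /\ pos v = pos w.
  by case/H => -> /pos_inj.
move: v0 w0 (pos_lt v) (pos_le v) (pos_lt w) (pos_le w).
case: (pos v) (pos w) => [x y] [x' y'] /=.
case: k k4 => [|[|[|[|k]]]] //= _ ? ? ? ? ? ? [e1 e2]; split; try congr pair; lia.
Qed.

(* The vertices (0, i+1) and (i, 0) stand for the same orbit of odd cells. *)
Lemma odd_cell_turn_inj k v w : (k < 4)%N ->
  iter k (@quarter_turn n) (odd_cell n (pos v)) = odd_cell n (pos w) ->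
  [\/ k = 0%N /\ v = w, wrap_rel (pos v) (pos w) | wrap_rel (pos w) (pos v)].
Proof.
move=> k4 /(congr1 (@coords n)).
rewrite coords_iter_turn !coords_odd_cell ?pos_lt ?pos_le //.
suff H : iter k (turn_coords n) ((2 * n + 2 * (pos v).1).+1, (2 * n + 2 * (pos v).2).-1)%N =
    ((2 * n + 2 * (pos w).1).+1, (2 * n + 2 * (pos w).2).-1)%N ->
    [\/ k = 0%N /\ pos v = pos w, wrap_rel (pos v) (pos w) | wrap_rel (pos w) (pos v)].
  by case/H => [[-> /pos_inj]||]; [constructor 1|constructor 2|constructor 3].
move: (pos_lt v) (pos_le v) (pos_lt w) (pos_le w); rewrite /wrap_rel.
case: (pos v) (pos w) => [x y] [x' y'] /=.
case: k k4 => [|[|[|[|k]]]] //= _ ? ? ? ? [e1 e2]; rewrite !xpair_eqE;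
  [constructor 1; split=> //; congr pair; lia | constructor 3; lia | exfalso; lia | constructor 2; lia].
Qed.

(** The turn sends the cell (2i+1, -1) of (i, 0) to the cell (1, 2i+1) of (0, i+1). *)
Lemma odd_cell_wrap v w : wrap_rel (pos v) (pos w) ->
  odd_cell n (pos v) = quarter_turn (odd_cell n (pos w)).
Proof.
move=> vw; apply: coords_inj; rewrite (coords_iter_turn 1).
rewrite !coords_odd_cell ?pos_lt ?pos_le // /turn_coords.
move: vw (pos_lt v) (pos_le v) (pos_lt w) (pos_le w); rewrite /wrap_rel.
case: (pos v) (pos w) => [x y] [x' y'] /=; rewrite xpair_eqE => *; congr pair; lia.
Qed.

(** Of the four neighbours of (2x, 2y), one is the reference partner, and the other three are the
    odd cells of the vertices reached by the three steps. *)
Lemma adjacent_even_odd v w : (0 < (pos v).1)%N ->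
  adjacent (even_cell n (pos v)) (odd_cell n (pos w)) = (pos w == pos v) || step_rel (pos v) (pos w).
Proof.
move=> v0; rewrite adjacentE coords_even_cell ?coords_odd_cell ?pos_lt ?pos_le //.
move: v0 (pos_lt v) (pos_le v) (pos_lt w) (pos_le w); rewrite /step_rel.
by case: (pos v) (pos w) => [x y] [x' y'] /=; rewrite !xpair_eqE; lia.
Qed.

Lemma adjacent_even_cell v (c : point n) : (0 < (pos v).1)%N ->
  adjacent (even_cell n (pos v)) c -> exists w, c = odd_cell n (pos w).
Proof.
move=> v0; rewrite adjacentE coords_even_cell ?pos_lt ?pos_le //.
have := coords_le c; case E: (coords c) => [a b]; move: v0 (pos_lt v) (pos_le v).
case: (pos v) => x y /= x0 xn yn /andP[_ b4] /andP[ad1 ad2].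
have xn' : ((a - 2 * n)./2 < n)%N by lia.
have yn' : ((b.+1 - 2 * n)./2 <= n)%N by lia.
have [w wE] := pos_onto xn' yn'; exists w; apply: coords_inj.
rewrite wE coords_odd_cell // E /=.
by congr pair; [move: ad1 | move: ad2]; lia.
Qed.

End Vertices.

(** * From permutations to tilings *)

Section Tilings.
Variable n : nat.
Implicit Types (v w : 'I_(n * n.+1)) (sigma : 'S_(n * n.+1)).
Local Notation turn := (@quarter_turn n).
Local Notation even v := (even_cell n (pos v)).
Local Notation odd_ v := (odd_cell n (pos v)).

Lemma parity_even_cell k v : odd (coords (iter k turn (even v))).1 = false.
Proof.
have E := coords_even_cell (pos_lt v) (pos_le v).
rewrite parity_turn ?E /=; first by lia.
by rewrite /cell -[X in odd X]/(coords (even v)).1 -[X in _ == odd X]/(coords (even v)).2 E /=; lia.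
Qed.

Lemma parity_odd_cell k v : odd (coords (iter k turn (odd_ v))).1.
Proof.
have E := coords_odd_cell (pos_lt v) (pos_le v); have n0 := pos_lt v.
rewrite parity_turn ?E /=; first by lia.
by rewrite /cell -[X in odd X]/(coords (odd_ v)).1 -[X in _ == odd X]/(coords (odd_ v)).2 E /=; lia.
Qed.

Lemma even_neq_odd k v k' w : iter k turn (even v) <> iter k' turn (odd_ w).
Proof.
by move=> /(congr1 (fun c => odd (coords c).1)); rewrite parity_even_cell parity_odd_cell.
Qed.

Lemma odd_cell_inj v w : odd_ v = odd_ w -> v = w.
Proof.
move=> /(congr1 (@coords n)); rewrite !coords_odd_cell ?pos_lt ?pos_le // => e.
apply: pos_inj; move: e (pos_lt v).
by case: (pos v) (pos w) => [a b] [a' b'] [e1 e2] n0; congr pair; lia.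
Qed.

(** Turning 3k' times undoes k' turns. *)
Lemma turn_shift k k' (c c' : point n) :
  iter k turn c = iter k' turn c' -> iter ((3 * k' + k) %% 4)%N turn c = c'.
Proof.
move=> e; rewrite -iter_turn_mod iterD e -iterD iter_turn_mod.
by have -> : ((3 * k' + k') %% 4 = 0)%N by lia.
Qed.

Lemma turn_region k (c : point n) : (iter k turn c \in quasi_square n) = (c \in quasi_square n).
Proof. by elim: k => //= k <-; rewrite quasi_square_turn. Qed.

Lemma turn_adjacent k (c c' : point n) : adjacent (iter k turn c) (iter k turn c') = adjacent c c'.
Proof. by elim: k => //= k <-; rewrite adjacent_turn. Qed.

Definition orbit_domino (k : nat) v w : {set point n} :=
  [set iter k turn (even v); iter k turn (odd_ w)].

Lemma imset_orbit_domino k v w : turn @: orbit_domino k v w = orbit_domino k.+1 v w.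
Proof. by rewrite /orbit_domino imsetU1 imset_set1. Qed.

Lemma orbit_domino_mod k v w : orbit_domino k v w = orbit_domino (k %% 4) v w.
Proof. by rewrite /orbit_domino !(iter_turn_mod k). Qed.

(** A shared cell determines the turn and the vertex, except that an odd cell may carry two names,
    related by a wrap. *)
Lemma orbit_domino_meet k v w k' v' w' c :
  (0 < (pos v).1)%N -> (0 < (pos v').1)%N ->
  c \in orbit_domino k v w -> c \in orbit_domino k' v' w' ->
  [\/ (k = k' %[mod 4])%N /\ v = v', (k = k' %[mod 4])%N /\ w = w',
      wrap_rel (pos w) (pos w') | wrap_rel (pos w') (pos w)].
Proof.
move=> v0 v'0; rewrite !inE.
have m4 m : (m %% 4 < 4)%N by rewrite ltn_mod.
have mE : ((3 * k' + k) %% 4 = 0 -> k = k' %[mod 4])%N by lia.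
case/orP=> /eqP-> /orP[] /eqP e; try by case: (even_neq_odd e).
- case: (even_cell_turn_inj (m4 _) v0 v'0 (turn_shift e)) => /mE kk' vv'.
  by constructor 1.
- by case: (even_neq_odd (esym e)).
- case: (odd_cell_turn_inj (m4 _) (turn_shift e)) => [[/mE kk' ww']||] //.
  + by constructor 2.
  + by constructor 3.
  + by constructor 4.
Qed.

(** Only vertices with x > 0 carry an even cell. On x = 0, [sigma] records under which name an odd
    cell is covered: (i, 0) if (0, i+1) is fixed, and (0, i+1) if it wraps. *)
Definition tiling_of sigma : {set {set point n}} :=
  [set orbit_domino kv.1 kv.2 (sigma kv.2)
    | kv : 'I_4 * 'I_(n * n.+1) in [set kv | 0 < (pos kv.2).1]%N].

Lemma tiling_ofP sigma A :
  reflect (exists k v, (0 < (pos v).1)%N /\ A = orbit_domino k v (sigma v))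
          (A \in tiling_of sigma).
Proof.
apply: (iffP imsetP) => [[[k v] /[!inE] /= v0 ->]|[k [v [v0 ->]]]]; first by exists k, v.
have k4 : (k %% 4 < 4)%N by rewrite ltn_mod.
by exists (Ordinal k4, v); rewrite ?inE //= -orbit_domino_mod.
Qed.

Section Allowed.
Variable sigma : 'S_(n * n.+1).
Hypothesis al : allowed sigma.

Lemma allowed_axis v : (pos v).1 = 0%N -> sigma v = v \/ wrap_rel (pos v) (pos (sigma v)).
Proof.
move=> v0; have := forallP al v; rewrite /allowed_rel /step_rel v0 /=.
by case/orP=> [/eqP/pos_inj|]; [left|right].
Qed.

Lemma allowed_origin v : pos v = (0, 0)%N -> sigma v = v.
Proof.
move=> v0; case: (@allowed_axis v) => //; first by rewrite v0.
by rewrite v0.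
Qed.

(** The hole vertices are fixed, hence not images of other vertices: (0, 0) has no move, and (0, 1)
    could only wrap to (0, 0), which is already taken. *)
Lemma allowed_region v : (0 < (pos v).1)%N -> odd_ (sigma v) \in quasi_square n.
Proof.
move=> v0; rewrite odd_cell_region; apply/negP => /andP[/eqP s1 s2].
have sv w : pos (sigma v) = pos w -> sigma w <> w.
  by move=> /pos_inj <- /perm_inj sv; move: v0; rewrite -sv s1.
have [s20|s21] : (pos (sigma v)).2 = 0%N \/ (pos (sigma v)).2 = 1%N by lia.
  by apply: (sv (sigma v)) => //; apply: allowed_origin; rewrite [LHS]surjective_pairing s1 s20.
case: (allowed_axis s1) => [/sv //|/and3P[_ _ /eqP]].
rewrite s21 => z0; have /perm_inj z1 := allowed_origin z0.
by move: s21; rewrite -z1 z0.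
Qed.

Lemma tiling_of_tiling : domino_tiling (tiling_of sigma).
Proof.
apply/andP; split; last first.
  apply/forall_inP => A /tiling_ofP[k [v [v0 ->]]]; apply/existsP.
  exists (iter k turn (even v)); apply/existsP; exists (iter k turn (odd_ (sigma v))).
  rewrite eqxx andbT turn_adjacent adjacent_even_odd //.
  move: (forallP al v) v0; rewrite /allowed_rel /wrap_rel; case: ((pos v).1) => //= m.
  by rewrite orbF.
apply/and3P; split; last first.
- apply/tiling_ofP => -[k [v [v0 /setP/(_ (iter k turn (even v)))]]].
  by rewrite !inE eqxx.
- apply/trivIsetP => A B /tiling_ofP[k [v [v0 ->]]] /tiling_ofP[k' [v' [v'0 ->]]].
  apply: contraNT => /pred0Pn[c /andP[/= cA cB]].
  (* If [sigma u] lies on x = 0, it is fixed and equals [u], or it wraps to [sigma u'] and equals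
     [u']; both contradict x > 0. *)
  have wF u u' : (0 < (pos u).1)%N -> (0 < (pos u').1)%N ->
      wrap_rel (pos (sigma u)) (pos (sigma u')) -> False.
    move=> u0 u'0 /and3P[/eqP s1 s2 /eqP s'].
    case: (allowed_axis s1) => [/perm_inj su|/and3P[_ _ /eqP ss]].
      by move: u0; rewrite -su s1.
    by move: u'0; rewrite -(@perm_inj _ sigma (sigma u) u') ?s1 //; apply: pos_inj; rewrite ss s'.
  have modE u : (k = k' %[mod 4])%N ->
      orbit_domino k u (sigma u) == orbit_domino k' u (sigma u).
    by move=> kk'; rewrite orbit_domino_mod kk' -orbit_domino_mod.
  case: (orbit_domino_meet v0 v'0 cA cB) => [[kk' <-]|[kk' /perm_inj <-]|/wF|/wF].
  + exact: modE.
  + exact: modE.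
  + by case.
  + by case.
rewrite eqEsubset; apply/andP; split; apply/subsetP => c.
  case/bigcupP => A /tiling_ofP[k [v [v0 ->]]].
  by rewrite in_set2 => /orP[] /eqP->; rewrite turn_region ?even_cell_region ?allowed_region.
move=> cD; apply/bigcupP.
have [oc|ec] := boolP (odd (coords c).1); last first.
  have [k [v [v0 ->]]] := even_cell_rep cD ec.
  exists (orbit_domino k v (sigma v)); last by rewrite !inE eqxx.
  by apply/tiling_ofP; exists k, v.
have [k [t cE]] := odd_cell_rep cD oc.
move: cD; rewrite cE turn_region odd_cell_region => tD.
have found m u : (0 < (pos (sigma^-1 u)%g).1)%N -> c = iter m turn (odd_ u) ->
    exists2 A, A \in tiling_of sigma & iter k turn (odd_ t) \in A.
  move=> u0; rewrite -cE => ->; exists (orbit_domino m (sigma^-1 u)%g u).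
    by apply/tiling_ofP; exists m, (sigma^-1 u)%g; rewrite permKV.
  by rewrite !inE eqxx orbT.
have [w0|] := posnP (pos (sigma^-1 t)%g).1; last by move=> t0; exact: found t0 cE.
have := allowed_axis w0; rewrite permKV => -[tw|wt].
  (* Here t = (0, i+1) is fixed, so its cell must be covered under its other name u = (i, 0), at the
     cost of one more turn. The preimage of [u] is off the axis, since the only wrap to [u] would
     start at [t]. *)
  rewrite -tw in w0.
  have u1 : ((pos t).2.-1 < n)%N by have := pos_lt t; have := pos_le t; lia.
  have [u uE] := pos_onto u1 (leq0n n).
  have tu : wrap_rel (pos t) (pos u) by move: tD; rewrite /wrap_rel w0 uE !eqxx andbT !andTb; lia.
  apply: (found k.+1 u); last by rewrite cE (odd_cell_wrap tu) iterSr.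
  rewrite lt0n; apply/eqP => s0; have := allowed_axis s0; rewrite permKV => -[us|].
    by move: tD s0; rewrite -us uE w0 /=; lia.
  rewrite /wrap_rel => /and3P[_ y0 /eqP]; rewrite uE => /(congr1 fst) yE.
  have {}yE : (pos t).2.-1 = (pos (sigma^-1 u)%g).2.-1 := yE.
  have /pos_inj /(congr1 sigma) : pos (sigma^-1 u)%g = pos t.
    rewrite (surjective_pairing (pos t)) (surjective_pairing (pos _)) s0 w0; congr pair.
    by move: tD; rewrite w0 eqxx andTb; lia.
  rewrite permKV {1}tw permKV => ut.
  by move: tu; rewrite ut wrap_rel_irr.
(* Here a wrap ends at [t], so the cell is covered under the name of the start of that wrap; three
   turns undo the one relating the two names. *)
apply: (found (k + 3)%N (sigma^-1 t)%g); last first.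
  by rewrite cE (odd_cell_wrap wt) -iterSr -addnS iterD iter_turn4.
rewrite lt0n; apply/eqP => s0; have := allowed_axis s0; rewrite permKV => -[e|].
  by move: wt; rewrite -(perm_inj e) wrap_rel_irr.
by move: wt; rewrite /wrap_rel => /and3P[_ y0 _] /and3P[_ _ /eqP e]; rewrite e in y0.
Qed.

Lemma tiling_of_invariant : quarter_turn_invariant (tiling_of sigma).
Proof.
apply/eqP/setP => A; apply/imsetP/tiling_ofP => [[B /tiling_ofP[k [v [v0 ->]]] ->]|].
  by exists k.+1, v; rewrite imset_orbit_domino.
move=> [k [v [v0 ->]]]; exists (orbit_domino (k + 3) v (sigma v)).
  by apply/tiling_ofP; exists (k + 3)%N, v.
rewrite imset_orbit_domino orbit_domino_mod [RHS]orbit_domino_mod; congr orbit_domino.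
lia.
Qed.

End Allowed.

(** For x > 0 the image is read off from the domino of the even cell. A vertex on x = 0 moves
    exactly when it is the image of a vertex with x > 0, so the values there are determined as
    well. *)
Lemma tiling_of_inj : {in [pred sigma | @allowed n sigma] &, injective tiling_of}.
Proof.
have step sigma tau : allowed sigma -> allowed tau -> tiling_of sigma = tiling_of tau ->
    forall v, (0 < (pos v).1)%N -> sigma v = tau v.
  move=> als alt e v v0.
  have : orbit_domino 0 v (sigma v) \in tiling_of tau.
    by rewrite -e; apply/tiling_ofP; exists 0%N, v.
  case/tiling_ofP => k [v' [v'0 E]].
  have : even v \in orbit_domino k v' (tau v') by rewrite -E !inE eqxx.
  rewrite !inE => /orP[/eqP e1|/eqP/(@even_neq_odd 0) //].
  have k4 m : (m %% 4 < 4)%N by rewrite ltn_mod.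
  case: (even_cell_turn_inj (k4 _) v0 v'0 (@turn_shift 0 k _ _ e1)) => km vv'; subst v'.
  have : odd_ (sigma v) \in orbit_domino k v (tau v) by rewrite -E !inE eqxx orbT.
  rewrite !inE => /orP[/eqP/esym/(@even_neq_odd _ _ 0) //|/eqP].
  rewrite iter_turn_mod; have -> : (k %% 4 = 0)%N by lia.
  exact: odd_cell_inj.
have fix_ sigma tau : allowed sigma -> allowed tau -> tiling_of sigma = tiling_of tau ->
    forall v, (pos v).1 = 0%N -> sigma v = v -> tau v = v.
  move=> als alt e v v0 sv; apply/eqP; apply/negPn/negP => /eqP tv.
  have [w0|w0] := posnP (pos (tau^-1 v)%g).1.
    have := allowed_axis alt w0; rewrite permKV => -[tw|/and3P[_ _ /eqP vE]].
      by apply: tv; rewrite {1}tw permKV.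
    apply: tv; apply: (allowed_origin alt).
    by rewrite (surjective_pairing (pos v)) v0 vE.
  have := step _ _ als alt e _ w0; rewrite permKV -{2}sv => /perm_inj wv.
  by rewrite wv v0 in w0.
move=> sigma tau als alt e; apply/permP => v.
have [v0|] := posnP (pos v).1; last exact: step.
have [sv|sv] := eqVneq (sigma v) v; first by rewrite (fix_ _ _ als alt e).
have [tv|tv] := eqVneq (tau v) v; first by rewrite (fix_ _ _ alt als (esym e)).
case: (allowed_axis als v0) => [s|/and3P[_ _ /eqP s]]; first by rewrite s eqxx in sv.
case: (allowed_axis alt v0) => [t|/and3P[_ _ /eqP t]]; first by rewrite t eqxx in tv.
by apply: pos_inj; rewrite s t.
Qed.

End Tilings.

(** * From tilings to permutations *)

Section TilingPermutation.
Variables (n : nat) (T : {set {set point n}}).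
Hypotheses (tT : domino_tiling T) (iT : quarter_turn_invariant T).
Implicit Types u v w : 'I_(n * n.+1).
Local Notation turn := (@quarter_turn n).
Local Notation even v := (even_cell n (pos v)).
Local Notation odd_ v := (odd_cell n (pos v)).

Let partT : partition T (quasi_square n). Proof. by case/andP: tT. Qed.

Lemma tiling_meet A B c : A \in T -> B \in T -> c \in A -> c \in B -> A = B.
Proof.
have tI := partition_trivIset partT.
by move=> AT BT cA cB; rewrite -(def_pblock tI AT cA) (def_pblock tI BT cB).
Qed.

Lemma tiling_turn k u w : orbit_domino 0 u w \in T -> orbit_domino k u w \in T.
Proof.
move=> uw; elim: k => // k IH; rewrite -imset_orbit_domino.
by rewrite -(eqP iT); apply: imset_f.
Qed.

Lemma tiling_partner u : (0 < (pos u).1)%N ->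
  exists2 w, orbit_domino 0 u w \in T & allowed_rel (pos u) (pos w).
Proof.
move=> u0; have := even_cell_region u0; rewrite -(cover_partition partT).
case/bigcupP => A AT uA.
have /existsP[c /existsP[c' /andP[cc' /eqP AE]]] := forall_inP (andP tT).2 A AT.
have [d ud AEd] : exists2 d, adjacent (even u) d & A = [set even u; d].
  move: uA; rewrite AE in_set2 => /orP[]/eqP->; [by exists c' | exists c; last exact: setUC].
  by move: cc'; rewrite !adjacentE; lia.
have [w dE] := adjacent_even_cell u0 ud; exists w; first by rewrite /orbit_domino /= -dE -AEd.
by move: ud; rewrite dE adjacent_even_odd // /allowed_rel orbA => ->.
Qed.

(** The common odd cell forces the two dominoes to coincide, hence their even cells, which represent
    each orbit once. *)
Lemma tiling_partner_odd k u w u' w' : (0 < (pos u).1)%N -> (0 < (pos u').1)%N ->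
  orbit_domino 0 u w \in T -> orbit_domino 0 u' w' \in T ->
  iter k turn (odd_ w) = odd_ w' -> u = u' /\ (k %% 4 = 0)%N.
Proof.
move=> u0 u'0 uw uw' ww'.
have E : orbit_domino k u w = orbit_domino 0 u' w'.
  apply: (tiling_meet (c := odd_ w')) => //; first exact: tiling_turn.
    by rewrite -ww' in_set2 eqxx orbT.
  by rewrite in_set2 eqxx orbT.
have : iter k turn (even u) \in orbit_domino 0 u' w' by rewrite -E in_set2 eqxx.
rewrite in_set2 => /orP[/eqP e|/eqP/even_neq_odd //].
have k4 : (k %% 4 < 4)%N by rewrite ltn_mod.
by rewrite iter_turn_mod in e; case: (even_cell_turn_inj k4 u0 u'0 e).
Qed.

Lemma tiling_partner_uniq u w w' : orbit_domino 0 u w \in T -> orbit_domino 0 u w' \in T -> w = w'.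
Proof.
move=> uw uw'; have E : orbit_domino 0 u w = orbit_domino 0 u w'.
  by apply: (tiling_meet (c := even u)) => //; rewrite in_set2 eqxx.
have : odd_ w \in orbit_domino 0 u w' by rewrite -E in_set2 eqxx orbT.
by rewrite in_set2 => /orP[/eqP/esym/(@even_neq_odd _ 0 _ 0) //|/eqP/odd_cell_inj].
Qed.

(** A vertex on x = 0 wraps precisely when a domino in the fundamental domain uses its odd cell
    under that name. *)
Definition tiling_step v : 'I_(n * n.+1) :=
  if (0 < (pos v).1)%N then odflt v [pick w | orbit_domino 0 v w \in T]
  else if [exists u, (0 < (pos u).1)%N && (orbit_domino 0 u v \in T)]
  then odflt v [pick w | wrap_rel (pos v) (pos w)] else v.

Lemma tiling_step_gt0 v : (0 < (pos v).1)%N -> orbit_domino 0 v (tiling_step v) \in T.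
Proof.
move=> v0; rewrite /tiling_step v0; case: pickP => [w //|none].
by have [w] := tiling_partner v0; rewrite none.
Qed.

(** A wrapping vertex has y > 1 because the odd cells of (0, 0) and (0, 1) lie in the hole; so its
    target (y-1, 0) is off the axis. *)
Lemma tiling_step_axis v : (pos v).1 = 0%N ->
  (tiling_step v = v /\ forall u, (0 < (pos u).1)%N -> orbit_domino 0 u v \notin T) \/
  [/\ wrap_rel (pos v) (pos (tiling_step v)), (1 < (pos v).2)%N
    & exists2 u, (0 < (pos u).1)%N & orbit_domino 0 u v \in T].
Proof.
move=> v0; rewrite /tiling_step v0 ltnn; case: existsP => [[u /andP[u0 uv]]|none].
  have : odd_ v \in quasi_square n.
    by apply: (subsetP (partitionS partT uv)); rewrite in_set2 eqxx orbT.
  rewrite odd_cell_region v0 eqxx andTb -ltnNge => v1; right; split=> //; last by exists u.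
  case: pickP => [w //|none].
  have y1 : ((pos v).2.-1 < n)%N by have := pos_le v; lia.
  have [w wE] := pos_onto y1 (leq0n n); have := none w.
  by rewrite /wrap_rel v0 wE !eqxx andbT (ltn_trans _ v1).
by left; split=> // u u0; apply/negP => uv; apply: none; exists u; rewrite u0.
Qed.

Lemma tiling_step_inj : injective tiling_step.
Proof.
have mixed v v' : (0 < (pos v).1)%N -> (pos v').1 = 0%N -> tiling_step v = tiling_step v' -> False.
  move=> v0 /tiling_step_axis[[-> none] e|[wr _ [u u0 uv'] e]].
    by have := none v v0; rewrite -e tiling_step_gt0.
  have := odd_cell_wrap wr; rewrite -e => /esym e1.
  (* The image of [v] and the vertex [v'] name the same orbit of odd cells, one turn apart, and both
     are covered; this would force 1 = 0 modulo 4. *)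
  by case: (@tiling_partner_odd 1 _ _ _ _ v0 u0 (tiling_step_gt0 v0) uv' e1).
have stay v v' : tiling_step v = v -> (pos v).1 = 0%N -> (pos v').1 = 0%N ->
    tiling_step v = tiling_step v' -> v = v'.
  move=> sv v0 /tiling_step_axis[[sv' _]|[+ y1 _]]; first by rewrite sv sv'.
  move=> + e; rewrite -e sv /wrap_rel => /and3P[_ _ /eqP vE].
  by move: v0 y1; rewrite vE => /=; lia.
move=> v v' e; have [v0|v0] := posnP (pos v).1; have [v'0|v'0] := posnP (pos v').1.
- have [[sv _]|[wv yv _]] := tiling_step_axis v0; first exact: stay.
  have [[sv' _]|[wv' yv' _]] := tiling_step_axis v'0; first exact/esym/stay.
  move: wv wv'; rewrite e /wrap_rel => /and3P[_ _ /eqP ->] /and3P[_ _ /eqP/(congr1 fst) yE].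
  apply: pos_inj; rewrite (surjective_pairing (pos v)) (surjective_pairing (pos v')) v0 v'0.
  have {}yE : (pos v).2.-1 = (pos v').2.-1 := yE.
  by congr pair; lia.
- by case: (mixed _ _ v'0 v0 (esym e)).
- by case: (mixed _ _ v0 v'0 e).
have sv := tiling_step_gt0 v0; rewrite e in sv.
by case: (@tiling_partner_odd 0 _ _ _ _ v0 v'0 sv (tiling_step_gt0 v'0) erefl).
Qed.

Lemma tiling_step_allowed : allowed (perm tiling_step_inj).
Proof.
apply/forallP => v; rewrite permE; have [v0|v0] := posnP (pos v).1.
  have [[-> _]|[wr _ _]] := tiling_step_axis v0; first by rewrite /allowed_rel eqxx.
  by rewrite /allowed_rel wr !orbT.
have [w vw alw] := tiling_partner v0.
by rewrite (tiling_partner_uniq (tiling_step_gt0 v0) vw).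
Qed.

(** The dominoes built from the permutation lie in [T] and already cover the region; each domino of
    [T] shares a cell with one of them and so equals it. *)
Lemma tiling_of_step : tiling_of (perm tiling_step_inj) = T.
Proof.
have sub A : A \in tiling_of (perm tiling_step_inj) -> A \in T.
  by case/tiling_ofP => k [v [v0 ->]]; apply: tiling_turn; rewrite permE tiling_step_gt0.
apply/setP => A; apply/idP/idP => [/sub //|AT].
have /andP[partS _] := tiling_of_tiling tiling_step_allowed.
have /set0Pn[c cA] := partition_neq0 partT AT.
have : c \in quasi_square n by apply: (subsetP (partitionS partT AT)).
rewrite -(cover_partition partS) => /bigcupP[B BS cB].
by rewrite (tiling_meet AT (sub B BS) cA cB).
Qed.

End TilingPermutation.

Lemma T4_allowed n : T4 n = #|[set sigma : 'S_(n * n.+1) | allowed sigma]|.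
Proof.
rewrite -(card_in_imset (f := @tiling_of n)); last first.
  by move=> sigma tau; rewrite !inE => als alt; apply: tiling_of_inj.
rewrite /T4; congr #|pred_of_set _|; apply/setP => T; rewrite inE; apply/andP/imsetP.
  case=> tT iT; exists (perm (tiling_step_inj tT iT)); last by rewrite tiling_of_step.
  by rewrite inE tiling_step_allowed.
case=> sigma; rewrite inE => al ->; split; first exact: tiling_of_tiling.
exact: tiling_of_invariant.
Qed.

Theorem theorem4p1 (n : nat) (hn : (1 <= n)%N) :
  (T4 n)%:Z = \det (1%:M + schroeder_mx n).
Proof. by rewrite T4_allowed -det_quotient_mx_allowed det_quotient_mx. Qed.
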